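(* There exists a function $f:\mathbb{N}\times\mathbb{N}\to\mathbb{N}$ such that the following holds. Let $\mathbb{F}$ be a finite field, $d\in\mathbb{N}$, and let $A$ be a matrix over $\mathbb{F}$ with columns indexed by a finite set $E$ and row space $W\subseteq\mathbb{F}^E$, such that $\mathrm{dsd}(M(A))=d$ and, for every $e\in E$, $\mathrm{dsd}(M/e)<d$, where $M/e$ is represented by any matrix over $\mathbb{F}$ with columns indexed by $E\setminus\{e\}$ whose row space is $\{(w_f)_{f\in E\setminus\{e\}}: w\in W,\ w_e=0\}$. Then $|E|\le f(|\mathbb{F}|,d)$.
   Context: $M(A)$ is the column matroid of $A$. A matroid is connected if any two elements lie in a common circuit; components are maximal connected restrictions. Deletion$^*$-depth of a matrix $B$ with $n$ columns: $\mathrm{dsd}(M(B))=0$ if the rank of $M(B)$ equals its number of elements; otherwise if $M(B)$ is disconnected, $\mathrm{dsd}(M(B))$ is the maximum of $\mathrm{dsd}(M(B_C))$ over components $C$ ($B_C$ the submatrix of the columns in $C$); otherwise $\mathrm{dsd}(M(B))=1+\min_{v\in\mathbb{F}^n}\mathrm{dsd}(M(B\oplus v^\top))$, where $B\oplus v^\top$ is $B$ with row $v^\top$ appended. This quantity depends only on the row space of $B$. The described matrix for $M/e$ represents the usual matroid contraction of $M(A)$ by $e$. *)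

(* Defs.v *)
From HB Require Import structures.
From mathcomp Require Import all_boot all_order all_algebra.
Set Implicit Arguments. Unset Strict Implicit. Unset Printing Implicit Defensive.
Import GRing.Theory.
Local Open Scope ring_scope.

(* Column matroid M(B|S) of the columns of B : 'M_(m,n) lying in S \subset 'I_n.
   The ground set is S; the columns are indexed by 'I_n. *)
Section ColumnMatroid.
Variable F : fieldType.
Variable n : nat.

Definition colsel (S : {set 'I_n}) : 'M[F]_n :=
  diag_mx (\row_j (if j \in S then 1 else 0)).

Definition mrank m (B : 'M[F]_(m, n)) (S : {set 'I_n}) : nat :=
  \rank (B *m colsel S).

Definition indep m (B : 'M[F]_(m, n)) (S : {set 'I_n}) : Prop :=
  mrank B S = #|S|%N.

Definition circuit m (B : 'M[F]_(m, n)) (C : {set 'I_n}) : Prop :=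
  ~ indep B C /\ (forall x, x \in C -> indep B (C :\ x)).

Definition connected m (B : 'M[F]_(m, n)) (S : {set 'I_n}) : Prop :=
  forall x y, x \in S -> y \in S -> x != y ->
    exists C, [/\ circuit B C, C \subset S, x \in C & y \in C].

Definition component m (B : 'M[F]_(m, n)) (S C : {set 'I_n}) : Prop :=
  [/\ C \subset S, C != set0, connected B C &
      forall D : {set 'I_n}, C \proper D -> D \subset S -> ~ connected B D].

(* dsd_le B S d : deletion*-depth of M(B|S) is at most d.
   Least-fixed-point reading of the recursive definition. *)
Inductive dsd_le : forall m, 'M[F]_(m, n) -> {set 'I_n} -> nat -> Prop :=
| dsd_indep m (B : 'M[F]_(m, n)) S d :
    indep B S -> dsd_le B S d
| dsd_disconn m (B : 'M[F]_(m, n)) S d :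
    ~ indep B S -> ~ connected B S ->
    (forall C, component B S C -> dsd_le B C d) -> dsd_le B S d
| dsd_conn m (B : 'M[F]_(m, n)) S d (v : 'rV[F]_n) :
    ~ indep B S -> connected B S ->
    dsd_le (col_mx B v) S d -> dsd_le B S d.+1.

Definition dsd m (B : 'M[F]_(m, n)) (S : {set 'I_n}) (d : nat) : Prop :=
  dsd_le B S d /\ forall d', (d' < d)%N -> ~ dsd_le B S d'.

(* B (ground set E\{e}, coordinate e ignored) represents the contraction
   M(A)/e: its row space restricted to E\{e} is {w|_(E\{e}) : w in rowspace A, w_e = 0}.
   Vectors on E\{e} are encoded as u : 'rV_n with u_e = 0. *)
Definition represents_contraction m k (A : 'M[F]_(m, n)) (e : 'I_n)
    (B : 'M[F]_(k, n)) : Prop :=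
  forall u : 'rV[F]_n, u 0 e = 0 ->
    ((exists y : 'rV[F]_n, (y <= B)%MS /\ forall f, f != e -> y 0 f = u 0 f) <->
     (exists w : 'rV[F]_n, [/\ (w <= A)%MS, w 0 e = 0 &
                            forall f, f != e -> w 0 f = u 0 f])).

End ColumnMatroid.

(* Main.v *)
(* Deletion*-depth at most h means that the columns can be placed along the root-to-leaf
   paths of a rooted forest of height h in such a way that the row space is cut out by
   one linear condition for each node. Fix such a forest of height d. If
   some node had too many child blocks, then, blocks being bounded by induction from the
   leaves and F being finite, many of them would be isomorphic copies of each other over
   the path above them. Delete one copy; what remains has a forest of height d - 1.
   Among the many remaining copies, one meets the span of the nodes used by another fixed
   copy only in the part that all copies share; duplicating the remaining nodes of that
   copy makes room for the deleted one, so the whole matroid has a forest of height d - 1,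
   a contradiction. *)
Require Import Defs.
From Stdlib Require Import Classical.
From mathcomp Require Import all_boot all_order all_algebra.
From mathcomp Require Import zify.

Set Implicit Arguments.
Unset Strict Implicit.
Unset Printing Implicit Defensive.
Import GRing.Theory.
Local Open Scope ring_scope.

(** * Kernel vectors, circuits and components *)

Section Kernel.
Variables (F : fieldType) (n m : nat) (B : 'M[F]_(m, n)).
Implicit Types (S C D : {set 'I_n}) (w x y : 'rV[F]_n).

Definition rsupp w : {set 'I_n} := [set e | w 0 e != 0].

Lemma rsuppP w S : reflect (forall e, e \notin S -> w 0 e = 0) (rsupp w \subset S).
Proof.
apply: (iffP subsetP) => [sub e|sub e]; last first.
  by rewrite inE; apply: contraR => /sub ->.
by move=> eS; apply/eqP; apply: contraR eS => we; apply: sub; rewrite inE.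
Qed.

Lemma notin_rsupp w e : (e \notin rsupp w) = (w 0 e == 0).
Proof. by rewrite inE negbK. Qed.

Lemma rsupp_eq0 w : (rsupp w == set0) = (w == 0).
Proof.
apply/eqP/eqP => [/setP w0|->]; last by apply/setP => e; rewrite !inE mxE eqxx.
by apply/rowP => e; apply/eqP; have := w0 e; rewrite !inE mxE => /negbFE.
Qed.

Lemma mul_colsel k (A : 'M[F]_(k, n)) S i j :
  (A *m colsel F S) i j = if j \in S then A i j else 0.
Proof. by rewrite mul_mx_diag !mxE; case: ifP; rewrite ?mulr1 ?mulr0. Qed.

Lemma colsel_id w S : rsupp w \subset S -> w *m colsel F S = w.
Proof.
move/rsuppP=> wS; apply/rowP => e; rewrite mul_colsel.
by case: ifPn => // /wS ->.
Qed.

Lemma sub_rsupp w S : (w <= B *m colsel F S)%MS -> rsupp w \subset S.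
Proof.
case/submxP => u ->; apply/rsuppP => e eS.
by rewrite mulmxA mul_colsel (negPf eS).
Qed.

Definition cycle x := B *m x^T == 0.

Lemma tr_colsel S : (colsel F S)^T = colsel F S.
Proof. exact: tr_diag_mx. Qed.

(** Masked to [S], the columns of the cokernel matrix are dependencies of [B], so orthogonality to
    the dependencies inside [S] already forces membership. *)
Lemma colselP w S : rsupp w \subset S ->
  reflect (forall x, rsupp x \subset S -> cycle x -> w *m x^T = 0)
          (w <= B *m colsel F S)%MS.
Proof.
move=> wS; apply: (iffP idP) => [/submxP [u ->] x xS /eqP Bx|orth].
  by rewrite -!mulmxA -tr_colsel -trmx_mul (colsel_id xS) Bx mulmx0.
rewrite submxE; apply/eqP/matrixP => i j; rewrite [RHS]mxE.
set K := cokermx _; pose x := (colsel F S *m col j K)^T.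
have xS : rsupp x \subset S.
  apply/rsuppP => e eS; rewrite /x trmx_mul tr_colsel mul_colsel (negPf eS) //.
have /(orth x xS): cycle x.
  have BK : B *m colsel F S *m K = 0 by apply: mulmx_coker.
  by rewrite /cycle trmxK mulmxA -[col j K]mulmx1 colE mulmx1 mulmxA BK mul0mx.
rewrite trmxK mulmxA (colsel_id wS) => wK.
have := congr1 (fun M : 'M_1 => M i 0) wK; rewrite [RHS]mxE => <-.
by rewrite !mxE; apply: eq_bigr => e _; rewrite [in RHS]mxE.
Qed.

Lemma rank_colsel_le S : (\rank (colsel F S) <= #|S|)%N.
Proof.
have ->: colsel F S = \sum_(e in S) delta_mx e e.
  apply/matrixP => i j; rewrite !mxE summxE.
  under eq_bigr do rewrite mxE.
  case: (eqVneq i j) => [->|ij].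
    case: ifP => jS.
      by rewrite (bigD1 j) //= !eqxx big1 ?addr0 // => e /andP[_]; rewrite eq_sym => /negPf->.
    by rewrite big1 // => e eS; case: eqVneq => // je; rewrite je eS in jS.
  by rewrite mulr0n big1 // => e _; case: eqVneq => //= <-; rewrite eq_sym (negPf ij).
rewrite -sum1_card; elim/big_ind2: _ => [|A a A' a' Aa Aa'|e _].
- by rewrite mxrank0.
- exact: leq_trans (mxrank_add _ _) (leq_add Aa Aa').
- by rewrite mxrank_delta.
Qed.

Lemma rank_colsel S : \rank (colsel F S) = #|S|.
Proof.
apply/eqP; rewrite eqn_leq rank_colsel_le /=.
(* The masks of [S] and of its complement add up to the identity, so both rank bounds are
   attained. *)
have := mxrank_add (colsel F S) (colsel F (~: S)).
have ->: colsel F S + colsel F (~: S) = 1%:M.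
  apply/matrixP => i j; rewrite !mxE inE.
  by case: (i \in S); case: (i == j); rewrite /= ?mulr1n ?mulr0n ?addr0 ?add0r.
rewrite mxrank1; have := rank_colsel_le (~: S); have := cardsC S; rewrite card_ord.
move=> Sn le1 le2; rewrite -(leq_add2r #|~: S|) Sn.
by apply: leq_trans le2 _; rewrite leq_add2l.
Qed.

Lemma indep_full S :
  indep B S <-> (forall w, rsupp w \subset S -> (w <= B *m colsel F S)%MS).
Proof.
rewrite /indep /mrank -rank_colsel.
have le := mxrank_leqif_sup (submxMl B (colsel F S)).
split=> [/eqP|full].
  rewrite le => sub w /colsel_id <-; exact: submx_trans (submxMl _ _) sub.
apply/eqP; rewrite le; apply/row_subP => i; apply: full.
apply/rsuppP => e eS; rewrite !mxE; case: eqVneq => [->|_]; last by rewrite mulr0n.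
by rewrite (negPf eS) mul0rn.
Qed.

Lemma indep_cycle S :
  indep B S <-> (forall x, rsupp x \subset S -> cycle x -> x = 0).
Proof.
rewrite indep_full; split=> [full x xS Bx|only0 w wS]; last first.
  by apply/(colselP wS) => x xS /(only0 x xS) ->; rewrite trmx0 mulmx0.
apply/rowP => e; rewrite mxE; case: (boolP (e \in S)) => [eS|]; last by move/rsuppP: xS; apply.
have dS: rsupp (delta_mx 0 e : 'rV[F]_n) \subset S.
  apply/rsuppP => e' e'S; rewrite mxE eqxx; case: eqVneq => // ee'.
  by rewrite ee' eS in e'S.
have := full _ dS; move/(colselP dS)/(_ x xS Bx).
rewrite -rowE => /rowP/(_ 0); by rewrite !mxE.
Qed.

(** Circuits as vectors: by [circuitP] the supports are exactly the circuits, and circuit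
    elimination becomes a subtraction. *)
Definition mincycle x := [/\ x != 0, cycle x &
  forall y, rsupp y \subset rsupp x -> cycle y -> y != 0 -> rsupp y = rsupp x].

Lemma circuitP C : circuit B C <-> exists2 x, mincycle x & rsupp x = C.
Proof.
split=> [[nind ind]|[x [x0 Bx minx] <-]].
  have [x xC [Bx x0]]: exists2 x, rsupp x \subset C & cycle x /\ x != 0.
    apply: NNPP => no; apply: nind; apply/indep_cycle => x xC Bx.
    by apply/eqP; apply/negPn/negP => x0; apply: no; exists x.
  have all_supp y : rsupp y \subset C -> cycle y -> y != 0 -> rsupp y = C.
    move=> yC By y0; apply/eqP; rewrite eqEsubset yC; apply/subsetP => e eC.
    apply: contraNT y0 => ey; apply/eqP.
    have /indep_cycle := ind e eC; apply => //.
    by rewrite subsetD1 yC ey.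
  have suppx := all_supp x xC Bx x0.
  by exists x => //; split => //; rewrite suppx.
split=> [/indep_cycle/(_ x (subxx _) Bx)/eqP|e ex]; first exact/negP.
apply/indep_cycle => y; rewrite subsetD1 => /andP[yx ey] By; apply/eqP.
by apply: contraNT ey => y0; rewrite (minx y).
Qed.

Lemma cycleB a x y : cycle x -> cycle y -> cycle (x - a *: y).
Proof.
move=> /eqP Bx /eqP By; rewrite /cycle linearB /= linearZ /= mulmxBr -scalemxAr.
by rewrite Bx By scaler0 subr0.
Qed.

Definition elim_at e x y := x - (x 0 e / y 0 e) *: y.

Lemma elim_atE e x y i : elim_at e x y 0 i = x 0 i - x 0 e / y 0 e * y 0 i.
Proof. by rewrite !mxE. Qed.

Lemma elim_at_cycle e x y : cycle x -> cycle y -> cycle (elim_at e x y).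
Proof. exact: cycleB. Qed.

Lemma rsupp_elim_at e x y :
  e \in rsupp y -> rsupp (elim_at e x y) \subset (rsupp x :|: rsupp y) :\ e.
Proof.
rewrite inE => ye; apply/rsuppP => i; rewrite !inE negb_and negbK negb_or !negbK elim_atE.
case/orP => [/eqP ->|/andP[/eqP -> /eqP ->]]; last by rewrite mulr0 subr0.
by rewrite divfK // subrr.
Qed.

(** A smaller dependency either contains [e] or can cancel one of its own coordinates in [x] without
    touching [e]; either way the support shrinks. *)
Lemma mincycle_through x e : cycle x -> e \in rsupp x ->
  exists y, [/\ mincycle y, e \in rsupp y & rsupp y \subset rsupp x].
Proof.
have [k] := ubnP #|rsupp x|; elim: k x => // k IH x /ltnSE xk Bx ex.
have shrink z : rsupp z \proper rsupp x -> cycle z -> e \in rsupp z ->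
    exists y, [/\ mincycle y, e \in rsupp y & rsupp y \subset rsupp x].
  move=> zx Bz ez.
  have [|y [my ey yz]] := IH z _ Bz ez.
    exact: leq_trans (proper_card zx) xk.
  by exists y; split => //; apply: subset_trans yz (proper_sub zx).
case: (classic (mincycle x)) => [mx|nmx]; first by exists x.
have [y [yx By y0]]: exists y, [/\ rsupp y \proper rsupp x, cycle y & y != 0].
  apply: NNPP => no; apply: nmx; split=> //.
    by rewrite -rsupp_eq0; apply/set0Pn; exists e.
  move=> y yx By y0; apply/eqP; rewrite eqEsubset yx; apply/negPn/negP => xy.
  by apply: no; exists y; split=> //; rewrite properE yx.
case: (boolP (e \in rsupp y)) => ey; first exact: (shrink y).
have [f fy] : exists f, f \in rsupp y by apply/set0Pn; rewrite rsupp_eq0.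
apply: (shrink (elim_at f x y)).
- have sub := rsupp_elim_at x fy.
  have fx: f \in rsupp x by apply: (subsetP (proper_sub yx)).
  rewrite (setUidPl (proper_sub yx)) in sub.
  exact: sub_proper_trans sub (properD1 fx).
- exact: elim_at_cycle.
- move: ey ex; rewrite !inE elim_atE => /negbNE/eqP ->.
  by rewrite mulr0 subr0.
Qed.

Lemma mincycle_not_sub x y :
  mincycle x -> mincycle y -> rsupp y \subset rsupp x -> rsupp y = rsupp x.
Proof. by move=> [_ _ minx] [y0 By _] yx; apply: minx. Qed.

(** Transitivity of lying in a common circuit, by induction on the size of the union: eliminating a
    common element yields new circuits through [a] and through [b]. *)
Lemma mincycle_trans c1 c2 a b :
  mincycle c1 -> mincycle c2 -> a \in rsupp c1 -> b \in rsupp c2 ->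
  rsupp c1 :&: rsupp c2 != set0 ->
  exists y, [/\ mincycle y, a \in rsupp y, b \in rsupp y &
                rsupp y \subset rsupp c1 :|: rsupp c2].
Proof.
have [k] := ubnP #|rsupp c1 :|: rsupp c2|.
elim: k c1 c2 => // k IH c1 c2 /ltnSE ck m1 m2 a1 b2 c12.
case: (boolP (a \in rsupp c2)) => [a2|a2].
  by exists c2; split=> //; apply: subsetUr.
case: (boolP (b \in rsupp c1)) => [b1|b1].
  by exists c1; split=> //; apply: subsetUl.
have shrink d1 d2 : mincycle d1 -> mincycle d2 -> a \in rsupp d1 -> b \in rsupp d2 ->
  rsupp d1 :&: rsupp d2 != set0 ->
  rsupp d1 :|: rsupp d2 \proper rsupp c1 :|: rsupp c2 ->
  exists y, [/\ mincycle y, a \in rsupp y, b \in rsupp y &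
                rsupp y \subset rsupp c1 :|: rsupp c2].
  move=> md1 md2 ad1 bd2 d12 dc.
  have [|y [my ay yb yd]] := IH d1 d2 _ md1 md2 ad1 bd2 d12.
    exact: leq_trans (proper_card dc) ck.
  by exists y; split => //; apply: subset_trans yd (proper_sub dc).
have /set0Pn[e /setIP[e1 e2]] := c12.
set U := rsupp c1 :|: rsupp c2 in ck shrink *.
pose u := elim_at e c1 c2.
have uU : rsupp u \subset U :\ e by apply: rsupp_elim_at.
have Bu : cycle u by case: m1 => _ B1 _; case: m2 => _ B2 _; apply: elim_at_cycle.
have au : a \in rsupp u.
  by move: a2 a1; rewrite !inE elim_atE => /negbNE/eqP ->; rewrite mulr0 subr0.
have bu : b \in rsupp u.
  move: b1 b2 e1 e2; rewrite !inE elim_atE => /negbNE/eqP -> b2 e1 e2.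
  by rewrite sub0r oppr_eq0 !mulf_neq0 ?invr_eq0.
have [c3 [m3 a3 c3u]] := mincycle_through Bu au.
have [c4 [m4 b4 c4u]] := mincycle_through Bu bu.
have c3U := subset_trans c3u uU; have c4U := subset_trans c4u uU.
have eU : e \in U by rewrite inE e1.
move: (c3U) (c4U); rewrite !subsetD1 => /andP[c3U' e3] /andP[c4U' e4].
(* As [c3] and [c4] miss [e], minimality makes [c3] meet [c2] at some [f] outside [c1], and [c4]
   meet [c1]. If [f] lies in [c4], the pair [c3], [c4] misses [e]; otherwise the pair [c1], [c4]
   misses [f]. *)
have /subsetPn[f f3 f1] : ~~ (rsupp c3 \subset rsupp c1).
  by apply/negP => /(mincycle_not_sub m1 m3) E; rewrite E e1 in e3.
have /subsetPn[g g4 g2] : ~~ (rsupp c4 \subset rsupp c2).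
  by apply/negP => /(mincycle_not_sub m2 m4) E; rewrite E e2 in e4.
have f2 : f \in rsupp c2 by have := subsetP c3U' f f3; rewrite inE (negPf f1).
have g1 : g \in rsupp c1 by have := subsetP c4U' g g4; rewrite inE (negPf g2) orbF.
case: (boolP (f \in rsupp c4)) => f4.
  apply: (shrink c3 c4) => //; first by apply/set0Pn; exists f; rewrite inE f3.
  apply: sub_proper_trans (properD1 eU); by rewrite subUset c3U.
apply: (shrink c1 c4) => //; first by apply/set0Pn; exists g; rewrite inE g1.
apply: (@sub_proper_trans _ _ (U :\ f)); last by apply: properD1; rewrite inE f2 orbT.
by rewrite subUset !subsetD1 subsetUl c4U' f1 f4.
Qed.

(** * Connected sets and components *)

Lemma connected_rsupp x : mincycle x -> connected B (rsupp x).
Proof.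
by move=> mx a b ax bx _; exists (rsupp x); split=> //; apply/circuitP; exists x.
Qed.

Lemma connected_set1 e : connected B [set e].
Proof. by move=> x y /set1P -> /set1P ->; rewrite eqxx. Qed.

Lemma component_ex S D : D \subset S -> D != set0 -> connected B D ->
  exists2 C, component B S C & D \subset C.
Proof.
have [k] := ubnP (#|S| - #|D|); elim: k D => // k IH D /ltnSE Dk DS D0 cD.
case: (classic (component B S D)) => [|nD]; first by exists D.
have [D' [DD' D'S cD']] :
    exists D', [/\ D \proper D', D' \subset S & connected B D'].
  apply: NNPP => no; apply: nD; split=> // D' DD' D'S cD'.
  by apply: no; exists D'.
have [||C] := IH D' _ D'S _ cD'.
- have := proper_card DD'; have := subset_leq_card D'S; lia.
- by apply: contraNneq D0 => D'0; rewrite D'0 in DD'; rewrite -subset0 proper_sub.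
- by exists C => //; apply: subset_trans (proper_sub DD') _.
Qed.

Lemma connected_union C D : connected B C -> connected B D ->
  C :&: D != set0 -> connected B (C :|: D).
Proof.
wlog suff cross : C D / connected B C -> connected B D -> forall e, e \in C :&: D ->
  forall a b, a \in C -> b \in D -> a != b ->
    exists Z, [/\ circuit B Z, Z \subset C :|: D, a \in Z & b \in Z].
  move=> cC cD /set0Pn[e eCD] a b /setUP[aC|aD] /setUP[bC|bD] ab.
  - have [Z [? ZC ? ?]] := cC a b aC bC ab.
    by exists Z; split=> //; apply: subset_trans ZC (subsetUl _ _).
  - exact: (cross C D cC cD e).
  - have [|Z [? ? ? ?]] := cross C D cC cD e eCD b a bC aD; first by rewrite eq_sym.
    by exists Z; split => //; rewrite setUC.
  - have [Z [? ZC ? ?]] := cD a b aD bD ab.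
    by exists Z; split=> //; apply: subset_trans ZC (subsetUr _ _).
move=> cC cD e /setIP[eC eD] a b aC bD ab.
case: (eqVneq a e) => [ae|ae].
  have aD : a \in D by rewrite ae.
  have [Z [? ZC ? ?]] := cD a b aD bD ab.
  by exists Z; split=> //; apply: subset_trans ZC (subsetUr _ _).
case: (eqVneq e b) => [eb|eb].
  have bC : b \in C by rewrite -eb.
  have [Z [? ZC ? ?]] := cC a b aC bC ab.
  by exists Z; split=> //; apply: subset_trans ZC (subsetUl _ _).
have [Z1 [/circuitP[c1 m1 <-] c1C a1 e1]] := cC a e aC eC ae.
have [Z2 [/circuitP[c2 m2 <-] c2D e2 b2]] := cD e b eD bD eb.
have [|y [my ay yb yc]] := mincycle_trans m1 m2 a1 b2.
  by apply/set0Pn; exists e; rewrite inE e1.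
exists (rsupp y); split=> //; first by apply/circuitP; exists y.
exact: subset_trans yc (setUSS c1C c2D).
Qed.

Lemma component_eq S C D e :
  component B S C -> component B S D -> e \in C -> e \in D -> C = D.
Proof.
move=> [CS _ cC maxC] [DS _ cD maxD] eC eD.
have cU : connected B (C :|: D).
  by apply: connected_union => //; apply/set0Pn; exists e; rewrite inE eC.
have US : C :|: D \subset S by rewrite subUset CS.
transitivity (C :|: D); apply/eqP; rewrite eqEsubset ?subsetUl ?subsetUr /= ?andbT.
  by apply/negPn/negP => nC; apply: (maxC (C :|: D)) => //; rewrite properE subsetUl.
by apply/negPn/negP => nD; apply: (maxD (C :|: D)) => //; rewrite properE subsetUr.
Qed.

(** Minimal dependencies span all dependencies, and each has a connected support, which lies in one
    component. *)
Lemma orth_components S w :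
  (forall C x, component B S C -> rsupp x \subset C -> cycle x -> w *m x^T = 0) ->
  forall x, rsupp x \subset S -> cycle x -> w *m x^T = 0.
Proof.
move=> orth x; have [k] := ubnP #|rsupp x|; elim: k x => // k IH x /ltnSE xk xS Bx.
case: (eqVneq x 0) => [->|]; first by rewrite trmx0 mulmx0.
rewrite -rsupp_eq0 => /set0Pn[e ex].
have [y [my ey yx]] := mincycle_through Bx ex.
have [_ By _] := my.
have y0 : rsupp y != set0 by apply/set0Pn; exists e.
have [C cC yC] := component_ex (subset_trans yx xS) y0 (connected_rsupp my).
have zx: rsupp (elim_at e x y) \subset rsupp x :\ e.
  by rewrite -{1}(setUidPl yx); apply: rsupp_elim_at.
have: w *m (elim_at e x y)^T = 0.
  apply: IH; last exact: elim_at_cycle.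
    apply: leq_trans xk; apply: leq_ltn_trans (subset_leq_card zx) _.
    exact: proper_card (properD1 ex).
  apply: subset_trans xS; apply: subset_trans zx (subsetDl _ _).
rewrite linearB /= linearZ /= mulmxBr -scalemxAr (orth C y) // scaler0 subr0.
by [].
Qed.

End Kernel.

(** * Forest representations *)

Section TreeRepresentation.
Variables (F : fieldType) (n : nat).
Implicit Types (c : nat -> 'I_n -> F) (l : nat -> 'I_n -> nat).
Implicit Types (S C : {set 'I_n}) (w x : 'rV[F]_n) (W : 'rV[F]_n -> Prop).

(** Each column is read as a vector with coordinates at the nodes of its path; this is the
    coordinate at node [(i, a)] of the combination with coefficients [w]. *)
Definition lsum c l w i a := \sum_(e | l i e == a) c i e * w 0 e.

(** Every node has a single parent, which makes the labels a forest. *)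
Definition refining l := forall i e e', l i.+1 e = l i.+1 e' -> l i e = l i e'.

(* A rooted forest of height h whose nodes are the pairs (level i, label a), the
   column e lying on the path of the nodes (i, l i e), with coordinate c i e there. *)
Definition tree_rep h S W := exists c l, refining l /\
  forall w, rsupp w \subset S ->
    (W w <-> forall i a, (i < h)%N -> lsum c l w i a = 0).

Definition rowspan m (B : 'M[F]_(m, n)) S w : Prop := (w <= B *m colsel F S)%MS.

Lemma refining_le l i j e e' :
  refining l -> (i <= j)%N -> l j e = l j e' -> l i e = l i e'.
Proof.
move=> lr ij; rewrite -(subnKC ij); elim: (j - i)%N => [|k IH]; first by rewrite addn0.
by rewrite addnS => /lr.
Qed.

Lemma lsum_lin c l a w w' i b :
  lsum c l (w + a *: w') i b = lsum c l w i b + a * lsum c l w' i b.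
Proof.
rewrite /lsum mulr_sumr -big_split; apply: eq_bigr => e _ /=.
by rewrite !mxE mulrDr mulrCA.
Qed.

Lemma lsum0 c l i b : lsum c l 0 i b = 0.
Proof. by rewrite /lsum big1 // => e _; rewrite mxE mulr0. Qed.

Lemma lsumZ c l a w i b : lsum c l (a *: w) i b = a * lsum c l w i b.
Proof. by rewrite -[a *: w]add0r lsum_lin lsum0 add0r. Qed.

Lemma lsumB c l w w' i b : lsum c l (w - w') i b = lsum c l w i b - lsum c l w' i b.
Proof. by rewrite -[- w']scaleN1r lsum_lin mulN1r. Qed.

Lemma lsum_outside c l w i b :
  (forall e, w 0 e != 0 -> l i e != b) -> lsum c l w i b = 0.
Proof.
move=> out; rewrite /lsum big1 // => e le; apply/eqP; rewrite mulf_eq0; apply/orP; right.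
by apply: contraTT le => /out.
Qed.

Lemma lsum_restrict c l w i b C :
  (forall e, l i e = b -> e \in C) -> lsum c l (w *m colsel F C) i b = lsum c l w i b.
Proof. by move=> inC; apply: eq_bigr => e /eqP /inC eC; rewrite mul_colsel eC. Qed.

Lemma dotmxE w x : (w *m x^T) 0 0 = \sum_e x 0 e * w 0 e.
Proof. by rewrite mxE; apply: eq_bigr => e _; rewrite mxE mulrC. Qed.

Lemma dotmx_eq0 w x : (w *m x^T == 0) = ((w *m x^T) 0 0 == 0).
Proof.
apply/eqP/eqP => [->|wx]; first by rewrite mxE.
by rewrite [w *m x^T]mx11_scalar wx raddf0.
Qed.

Lemma colsel_mul S C : C \subset S -> colsel F S *m colsel F C = colsel F C.
Proof.
move/subsetP=> CS; apply/matrixP => i j; rewrite mul_colsel !mxE.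
by case: eqVneq => [->|_]; rewrite ?mulr1n ?mulr0n; case: ifP => // /CS ->.
Qed.

Lemma rowspan_restrict m (B : 'M[F]_(m, n)) S C w :
  C \subset S -> rowspan B S w -> rowspan B C (w *m colsel F C).
Proof.
by move=> CS /submxP[u ->]; rewrite /rowspan -!mulmxA colsel_mul // submxMl.
Qed.

(** A dependency inside another component is disjoint from [C], hence orthogonal to [w]. *)
Lemma rowspan_component m (B : 'M[F]_(m, n)) S C w :
  component B S C -> rsupp w \subset C -> (rowspan B C w <-> rowspan B S w).
Proof.
move=> cC wC; have [CS _ _ _] := cC; split=> [wB|/(rowspan_restrict CS)]; last by rewrite colsel_id.
apply/(colselP B (subset_trans wC CS)); apply: orth_components => C' x cC' xC' Bx.
case: (eqVneq C C') => [E|CC'].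
  by rewrite -E in xC'; move/(colselP B wC): wB; apply.
apply/eqP; rewrite dotmx_eq0 dotmxE big1 // => e _.
case: (boolP (e \in C)) => eC; last by rewrite (rsuppP _ _ wC) // mulr0.
rewrite (rsuppP _ _ xC') ?mul0r //; apply/negP => eC'.
by rewrite (component_eq cC cC' eC eC') eqxx in CC'.
Qed.

Lemma rowspan_add_row m (B : 'M[F]_(m, n)) (v : 'rV[F]_n) S w :
  rowspan (col_mx B v) S w <->
  (w <= B *m colsel F S + v *m colsel F S)%MS.
Proof. by rewrite /rowspan mul_col_mx addsmxE. Qed.

(** A new row raises the dimension by at most one; a dependency of [B] not orthogonal to [v]
    recovers the old row space. *)
Lemma add_row_hyperplane m (B : 'M[F]_(m, n)) (v : 'rV[F]_n) S : exists x : 'rV[F]_n,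
  forall w, rowspan B S w <-> rowspan (col_mx B v) S w /\ w *m x^T = 0.
Proof.
have vS : rsupp (v *m colsel F S) \subset S.
  by apply/rsuppP => e eS; rewrite mul_colsel (negPf eS).
case: (boolP (v *m colsel F S <= B *m colsel F S)%MS) => [vB|/(colselP B vS) nv].
  exists 0 => w; rewrite rowspan_add_row trmx0 mulmx0.
  split=> [wB|[wBv _]]; first by split=> //; apply: submx_trans wB (addsmxSl _ (v *m colsel F S)).
  by apply: submx_trans wBv _; rewrite addsmx_sub submx_refl.
have [x [xS Bx vx]] : exists x, [/\ rsupp x \subset S, cycle B x &
    v *m colsel F S *m x^T != 0].
  apply: NNPP => no; apply: nv => x xS Bx; apply/eqP/negPn/negP => vx.
  by apply: no; exists x.
exists x => w; rewrite rowspan_add_row; split=> [wB|[/sub_addsmxP[[u1 u2] /= ->]]].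
  split; first exact: submx_trans wB (addsmxSl _ (v *m colsel F S)).
  by move/(colselP B (sub_rsupp wB)): (wB); apply.
rewrite mulmxDl.
have -> : u1 *m (B *m colsel F S) *m x^T = 0.
  have sub : (u1 *m (B *m colsel F S) <= B *m colsel F S)%MS by apply: submxMl.
  by move/(colselP B (sub_rsupp sub)): sub; apply.
rewrite add0r [u2]mx11_scalar -mulmxA mul_scalar_mx => /eqP.
rewrite scalemx_eq0 (negPf vx) orbF => /eqP ->.
by rewrite raddf0 mul0mx addr0 /rowspan submxMl.
Qed.

(** The hyperplane condition becomes a new root common to all columns, and every other level moves
    down by one. *)
Lemma tree_rep_add_row m (B : 'M[F]_(m, n)) (v : 'rV[F]_n) S h :
  tree_rep h S (rowspan (col_mx B v) S) -> tree_rep h.+1 S (rowspan B S).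
Proof.
case=> c [l [lr rep]]; have [x xP] := add_row_hyperplane B v S.
exists (fun i => if i is i'.+1 then c i' else x 0).
exists (fun i => if i is i'.+1 then l i' else fun=> 0%N); split=> [[|i] e e' //|w wS].
  exact: lr.
rewrite xP; split=> [[wBv wx] [|i] a|w0].
- move=> _; rewrite /lsum; case: (eqVneq 0%N a) => [_|]; last by rewrite big_pred0_eq.
  by rewrite /= -dotmxE wx mxE.
- by rewrite ltnS; apply: (iffLR (rep w wS)).
split; first by apply/(rep w wS) => i a ih; apply: (w0 i.+1 a).
by apply/eqP; rewrite dotmx_eq0 dotmxE; apply/eqP; apply: (w0 0%N 0%N).
Qed.

Lemma tree_rep_components m (B : 'M[F]_(m, n)) S h :
  (forall C, component B S C -> tree_rep h C (rowspan B C)) ->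
  tree_rep h S (rowspan B S).
Proof.
move=> repC.
have [p pP] : exists p : {set 'I_n} -> (nat -> 'I_n -> F) * (nat -> 'I_n -> nat),
    forall C, component B S C -> refining (p C).2 /\
      forall w, rsupp w \subset C ->
       (rowspan B C w <-> forall i a, (i < h)%N -> lsum (p C).1 (p C).2 w i a = 0).
  apply: (@fin_all_exists _ _ (fun C q => component B S C -> refining q.2 /\
    forall w, rsupp w \subset C -> (rowspan B C w <->
      forall i a, (i < h)%N -> lsum q.1 q.2 w i a = 0))) => C.
  case: (classic (component B S C)) => [cC|nC].
    by have [c [l cl]] := repC C cC; exists (c, l).
  by exists (fun _ _ => 0, fun _ _ => 0%N).
have [K KP] : exists K : 'I_n -> {set 'I_n},
    forall e, e \in S -> component B S (K e) /\ e \in K e.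
  apply: (@fin_all_exists _ _ (fun e C => e \in S -> component B S C /\ e \in C)) => e.
  case: (boolP (e \in S)) => eS; last by exists set0.
  have eS1 : [set e] \subset S by rewrite sub1set.
  have e0 : [set e] != set0 by apply/set0Pn; exists e; rewrite inE.
  have [C cC eC] := component_ex eS1 e0 (@connected_set1 _ _ _ B e).
  by exists C => _; split=> //; rewrite -sub1set.
have Kuniq C e : component B S C -> e \in C -> K e = C.
  move=> cC eC; have [CS _ _ _] := cC; have [cK eK] := KP e (subsetP CS e eC).
  exact: component_eq cK cC eK eC.
pose c i e := (p (K e)).1 i e.
(* Storing the component in the label keeps the forests apart; the successor taken next reserves
   label 0 for columns outside [S]. *)
pose l i e := if e \in S then pickle (K e, (p (K e)).2 i e) else 0%N.
exists c, (fun i e => if e \in S then (l i e).+1 else 0%N); split.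
  move=> i e e'; rewrite /l; case: (boolP (e \in S)); case: (boolP (e' \in S)) => // e'S eS [].
  move/(pcan_inj pickleK) => [EK El]; rewrite EK in El *.
  by have [cK _] := KP e' e'S; rewrite (proj1 (pP _ cK) i e e' El).
move=> w wS; set l' := (fun i e => _).
have lsumC C i a : component B S C ->
    lsum c l' w i (pickle (C, a)).+1 = lsum (p C).1 (p C).2 (w *m colsel F C) i a.
  move=> cC; have [CS _ _ _] := cC.
  rewrite /lsum big_mkcond [RHS]big_mkcond; apply: eq_bigr => e _ /=.
  rewrite mul_colsel /c /l' /l; case: (boolP (e \in S)) => eS; last first.
    by rewrite (rsuppP _ _ wS) //; case: (e \in C); rewrite !mulr0 /=; case: ifP.
  rewrite eqSS (inj_eq (pcan_inj pickleK)) xpair_eqE.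
  case: (eqVneq (K e) C) => [<-|KC]; first by have [_ ->] := KP e eS.
  case: (boolP (e \in C)) => [/(Kuniq C e cC) E|_]; first by rewrite E eqxx in KC.
  by rewrite mulr0 /=; case: ifP.
have cond C : component B S C -> (rowspan B C (w *m colsel F C) <->
    forall i a, (i < h)%N -> lsum (p C).1 (p C).2 (w *m colsel F C) i a = 0).
  move=> cC; apply: (proj2 (pP C cC)); apply/rsuppP => e eC.
  by rewrite mul_colsel (negPf eC).
split=> [wB i a ih|w0].
  case: (classic (exists2 e, e \in S & l' i e = a)) => [[e eS <-]|no].
    have [cK _] := KP e eS; have [KS _ _ _] := cK.
    rewrite /l' eS /l eS lsumC //; apply: (iffLR (cond _ cK)) => //.
    exact: rowspan_restrict wB.
  apply: lsum_outside => e we; apply: contra_notN no => /eqP la.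
  by exists e => //; apply: contraR we => eS; rewrite (rsuppP _ _ wS).
apply/(colselP B wS); apply: orth_components => C x cC xC Bx.
have wC : rowspan B C (w *m colsel F C).
  by apply/(cond C cC) => i a ih; rewrite -lsumC //; apply: w0.
have := wC; move/(colselP B (sub_rsupp wC))/(_ x xC Bx).
by rewrite -mulmxA -tr_colsel -trmx_mul colsel_id.
Qed.

Lemma dsd_le_tree m (B : 'M[F]_(m, n)) S h :
  dsd_le B S h -> tree_rep h S (rowspan B S).
Proof.
elim=> {m B S h} [m B S h|m B S h _ _ _ IH|m B S h v _ _ _ IH].
(* Independent columns have full row space, so every node gets the zero condition. *)
- move/indep_full => full; exists (fun _ _ => 0), (fun _ _ => 0%N).
  split=> // w wS; split=> [_ i a _|_]; last exact: full.
  by rewrite /lsum big1 // => e _; rewrite mul0r.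
- exact: tree_rep_components.
- exact: tree_rep_add_row IH.
Qed.

(** * From forests back to depth *)

(* The part of a circuit inside one root block is still a kernel vector, so by
   minimality no circuit meets two root blocks. *)
Lemma connected_root_label m (B : 'M[F]_(m, n)) S h c l :
  refining l ->
  (forall w, rsupp w \subset S ->
     (rowspan B S w <-> forall i a, (i < h)%N -> lsum c l w i a = 0)) ->
  connected B S -> forall e1 e2, e1 \in S -> e2 \in S -> l 0%N e1 = l 0%N e2.
Proof.
move=> lr rep conS e1 e2 e1S e2S; case: (eqVneq e1 e2) => [->//|e12].
have [Z [/circuitP[x mx <-] xS e1x e2x]] := conS e1 e2 e1S e2S e12.
have [x0 Bx minx] := mx.
pose Q := [set e | l 0%N e == l 0%N e1]; pose y := x *m colsel F Q.
have yx : rsupp y \subset rsupp x.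
  by apply/rsuppP => e; rewrite notin_rsupp mul_colsel => /eqP ->; rewrite if_same.
have yS := subset_trans yx xS.
have rowQ w : rowspan B S w -> rowspan B S (w *m colsel F Q).
  move=> wB; have wS := sub_rsupp wB.
  have wQS : rsupp (w *m colsel F Q) \subset S.
    by apply/rsuppP => e eS; rewrite mul_colsel (rsuppP _ _ wS) // if_same.
  apply/(rep _ wQS) => i a ih; have w0 := iffLR (rep _ wS) wB i a ih.
  case: (classic (exists2 e, e \in Q & l i e = a)) => [[e]|no].
    rewrite inE => /eqP eQ la; rewrite lsum_restrict // => e' e'a.
    by rewrite inE -eQ (refining_le lr (leq0n i) (etrans e'a (esym la))).
  apply: lsum_outside => e; rewrite mul_colsel; case: ifP => eQ; last by rewrite eqxx.
  by move=> _; apply: contra_notN no => /eqP la; exists e.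
have By : cycle B y.
  rewrite /cycle -(colsel_id yS) trmx_mul tr_colsel mulmxA; apply/eqP/row_matrixP => i.
  rewrite row_mul row0.
  have /rowQ wB : rowspan B S (row i (B *m colsel F S)) by apply: row_sub.
  move/(colselP B (sub_rsupp wB))/(_ x xS Bx): (wB).
  by rewrite /y trmx_mul tr_colsel mulmxA.
have : e2 \in rsupp y.
  rewrite (minx y yx By) // -rsupp_eq0; apply/set0Pn; exists e1.
  by move: e1x; rewrite /y !inE mul_colsel inE eqxx.
by rewrite /y !inE mul_colsel inE; case: (eqVneq (l 0%N e2)) => [->|]; rewrite ?eqxx.
Qed.

(** All columns share one root. Dropping its condition enlarges the row space by at most one
    dimension, and [v] spans the difference. *)
Lemma tree_rep_connected m (B : 'M[F]_(m, n)) S h :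
  ~ indep B S -> connected B S -> tree_rep h.+1 S (rowspan B S) ->
  exists v : 'rV[F]_n, tree_rep h S (rowspan (col_mx B v) S).
Proof.
move=> nind conS [c [l [lr rep]]].
have root := connected_root_label lr rep conS.
have [a0 a0P] : exists a0, forall e, e \in S -> l 0%N e = a0.
  case: (set_0Vmem S) => [->|[e eS]]; first by exists 0%N => e; rewrite inE.
  by exists (l 0%N e) => e' e'S; apply: root.
have level0 w a : rsupp w \subset S -> a != a0 -> lsum c l w 0 a = 0.
  move=> wS aa0; apply: lsum_outside => e we; rewrite a0P 1?eq_sym //.
  by apply: contraR we => eS; rewrite (rsuppP _ _ wS).
pose W' w := forall i a, (i < h)%N -> lsum c l w i.+1 a = 0.
have WP w : rsupp w \subset S -> (rowspan B S w <-> lsum c l w 0 a0 = 0 /\ W' w).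
  move=> wS; rewrite rep //; split=> [w0|[w0 w1]].
    by split=> [|i a ih]; apply: w0.
  case=> [|i] a ih; last exact: w1.
  by case: (eqVneq a a0) => [->|/(level0 w a wS)].
have [v [vS v1 vP]] : exists v, [/\ rsupp v \subset S, W' v &
    forall w, rsupp w \subset S -> W' w -> exists a, rowspan B S (w - a *: v)].
  case: (classic (exists2 v, rsupp v \subset S & W' v /\ lsum c l v 0 a0 != 0)).
    case=> v vS [v1 v0]; exists v; split=> // w wS w1.
    exists (lsum c l w 0 a0 / lsum c l v 0 a0); apply/WP.
      apply/rsuppP => e eS; rewrite !mxE (rsuppP _ _ wS) // (rsuppP _ _ vS) //.
      by rewrite mulr0 subr0.
    split; first by rewrite lsumB lsumZ divfK // subrr.
    by move=> i a ih; rewrite lsumB lsumZ w1 // v1 // mulr0 subr0.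
  move=> no; exists 0; split=> [||w wS w1].
  - by apply/rsuppP => e _; rewrite mxE.
  - by move=> i a _; rewrite lsum0.
  exists 0; rewrite scaler0 subr0; apply/WP => //; split=> //.
  by apply/eqP/negPn/negP => w0; apply: no; exists w.
exists v, (fun i => c i.+1), (fun i => l i.+1); split=> [i e e'|w wS]; first exact: lr.
rewrite rowspan_add_row (colsel_id vS); split.
  case/sub_addsmxP => [[u1 u2] /= ->] i a ih.
  rewrite [u2]mx11_scalar mul_scalar_mx.
  have uB : rowspan B S (u1 *m (B *m colsel F S)) by rewrite /rowspan submxMl.
  have [_ u1W] := iffLR (WP _ (sub_rsupp uB)) uB.
  have := lsum_lin c l (u2 0 0) (u1 *m (B *m colsel F S)) v i.+1 a.
  by rewrite u1W // v1 // mulr0 addr0.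
move=> w1; have [a wB] := vP w wS w1.
rewrite -[w](subrK (a *: v)); apply: addmx_sub_adds => //.
exact: scalemx_sub.
Qed.

Lemma tree_dsd_le m (B : 'M[F]_(m, n)) S h :
  tree_rep h S (rowspan B S) -> dsd_le B S h.
Proof.
elim: h m B S => [|h IH] m B S rep.
  apply: dsd_indep; apply/indep_full => w wS.
  by have [c [l [_ rep0]]] := rep; apply: (iffRL (rep0 w wS)).
(* Stated for any set, since splitting into components keeps the height and only the connected step
   lowers it. *)
have conn S' : connected B S' -> tree_rep h.+1 S' (rowspan B S') -> dsd_le B S' h.+1.
  move=> cS' repS'; case: (classic (indep B S')) => [|nind]; first exact: dsd_indep.
  by have [v /IH] := tree_rep_connected nind cS' repS'; apply: dsd_conn.
case: (classic (indep B S)) => [|nind]; first exact: dsd_indep.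
case: (classic (connected B S)) => [|ncon]; first by move/conn; apply.
apply: dsd_disconn => // C cC; have [CS _ conC _] := cC; apply: conn => //.
have [c [l [lr repS]]] := rep; exists c, l; split=> // w wC.
by rewrite (rowspan_component cC wC); apply: repS; apply: subset_trans CS.
Qed.

Lemma tree_rep_mono h h' S W : (h <= h')%N -> tree_rep h S W -> tree_rep h' S W.
Proof.
(* Zero coefficients make the conditions of the added levels void. *)
move=> hh' [c [l [lr rep]]]; exists (fun i e => if (i < h)%N then c i e else 0), l.
split=> // w wS; rewrite rep //; split=> w0 i a ih.
  rewrite /lsum; case: ltnP => [/w0|_]; first exact.
  by rewrite big1 // => e _; rewrite mul0r.
by rewrite -[RHS](w0 i a (leq_trans ih hh')) /lsum ih.
Qed.

(** A forest of the contraction describes exactly the vectors in the row space of [A] that vanish at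
    [e]. *)
Lemma contraction_tree m k (A : 'M[F]_(m, n)) e (B : 'M[F]_(k, n)) h :
  represents_contraction A e B -> dsd_le B [set~ e] h ->
  tree_rep h [set~ e] (fun w => (w <= A)%MS).
Proof.
move=> contr /dsd_le_tree[c [l [lr rep]]]; exists c, l; split=> // w we.
rewrite -(rep w we).
have w0 : w 0 e = 0 by apply: (rsuppP _ _ we); rewrite !inE eqxx.
have [toA toB] := contr w w0; split=> [wA|/submxP[u wu]].
  have [|y [yB yw]] := toB; first by exists w.
  rewrite /rowspan; have -> : w = y *m colsel F [set~ e].
    apply/rowP => f; rewrite mul_colsel !inE.
    by case: eqVneq => [->|/yw ->].
  exact: submxMr.
have [|w' [w'A w'e w'w]] := toA.
  exists (u *m B); split=> [|f fe]; first exact: submxMl.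
  by rewrite wu mulmxA mul_colsel !inE fe.
suff -> : w = w' by [].
by apply/rowP => f; case: (eqVneq f e) => [->|/w'w //]; rewrite w0 w'e.
Qed.

End TreeRepresentation.

(** * Restoring a deleted copy *)

Section Duplication.
Variables (F : fieldType) (n m : nat) (A : 'M[F]_(m, n)).
Variables (d s t k : nat) (x : 'I_t.+2 -> 'I_s -> 'I_n).

(** With copies indexed by [j] and their columns by [r], this places one coefficient pattern on a
    chosen copy. *)
Definition push j (y : 'rV[F]_s) : 'rV[F]_n := y *m \matrix_(r, e) (x j r == e)%:R.

Hypothesis x_inj : forall j j' r r', x j r = x j' r' -> j = j' /\ r = r'.

Lemma rVsubE (u v : 'rV[F]_n) e : (u - v) 0 e = u 0 e - v 0 e.
Proof. by rewrite !mxE. Qed.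

Lemma push_in j y r : push j y 0 (x j r) = y 0 r.
Proof.
rewrite mxE (bigD1 r) //= mxE eqxx mulr1 big1 ?addr0 // => r' r'r.
rewrite mxE; case: eqP => [/x_inj[_ E]|]; last by rewrite mulr0.
by rewrite E eqxx in r'r.
Qed.

Lemma push_out j y e : (forall r, x j r != e) -> push j y 0 e = 0.
Proof. by move=> out; rewrite mxE big1 // => r _; rewrite mxE (negPf (out r)) mulr0. Qed.

Lemma push_other j j' y r : j != j' -> push j y 0 (x j' r) = 0.
Proof.
move=> jj'; apply: push_out => r'; apply: contraNN jj' => /eqP/x_inj[-> _].
exact: eqxx.
Qed.

Lemma lsum_push c l j y i a :
  lsum c l (push j y) i a = \sum_(r | l i (x j r) == a) c i (x j r) * y 0 r.
Proof.
rewrite /lsum; under eq_bigr do rewrite mxE mulr_sumr.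
rewrite exchange_big [RHS]big_mkcond; apply: eq_bigr => r _ /=.
case: ifP => la; last first.
  rewrite big1 // => e le; rewrite mxE; case: eqP => [E|_]; last by rewrite !mulr0.
  by rewrite E le in la.
rewrite (bigD1 (x j r)) //= mxE eqxx mulr1 big1 ?addr0 // => e /andP[_ ex].
by rewrite mxE eq_sym (negPf ex) !mulr0.
Qed.

Lemma lsum_sum c l (I : finType) (a : I -> F) (w : I -> 'rV[F]_n) i b :
  lsum c l (\sum_p a p *: w p) i b = \sum_p a p * lsum c l (w p) i b.
Proof.
elim/big_rec2: _ => [|p u v _ <-]; first exact: lsum0.
by rewrite addrC lsum_lin addrC.
Qed.

Variables (c : nat -> 'I_n -> F) (l : nat -> 'I_n -> nat).
Hypothesis rep : forall w : 'rV[F]_n, (w <= A)%MS <-> forall i a, (i < d)%N -> lsum c l w i a = 0.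
(** The copies are isomorphic: they share the path above level [k], and from level [k] on each has
    nodes of its own. *)
Hypothesis c_copy : forall i j j' r, (i < d)%N -> c i (x j r) = c i (x j' r).
Hypothesis l_copy : forall i j j' r r', (i < d)%N ->
  (l i (x j r) == l i (x j r')) = (l i (x j' r) == l i (x j' r')).
Hypothesis l_shared : forall i j j' r r', (i < k)%N -> (i < d)%N ->
  l i (x j r) = l i (x j' r').
Hypothesis l_private : forall i j r e, (k <= i)%N -> (i < d)%N ->
  l i e = l i (x j r) -> exists r', e = x j r'.

(* The vector [push j y] lies in the span of the shared nodes of the copies. *)
Definition private_zero j y :=
  forall i a, (k <= i)%N -> (i < d)%N -> lsum c l (push j y) i a = 0.

Lemma private_zero_copy j j' y : private_zero j y -> private_zero j' y.
Proof.
move=> z i a ki id; rewrite lsum_push.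
case: (pickP (fun r => l i (x j' r) == a)) => [r /eqP <-|no]; last by rewrite big_pred0.
rewrite -[RHS](z i (l i (x j r)) ki id) lsum_push; apply: eq_big => r'.
  exact: l_copy.
by move=> _; rewrite (c_copy j' j).
Qed.

(** Shared nodes receive the same sum from both copies, and private nodes receive zero. *)
Lemma private_zero_sub j j' y : private_zero j y -> (push j y - push j' y <= A)%MS.
Proof.
move=> z; apply/rep => i a id; rewrite lsumB; case: (leqP k i) => [ki|ik].
  by rewrite z // (private_zero_copy j' z) // subrr.
apply/eqP; rewrite subr_eq0 !lsum_push; apply/eqP; apply: eq_big => r.
  by rewrite (l_shared j j' r r).
by move=> _; rewrite (c_copy j j').
Qed.

(** A private node of copy [j] sees no column outside that copy. *)
Lemma sub_private_zero j (y : 'rV[F]_s) (w : 'rV[F]_n) :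
  (w <= A)%MS -> (forall r, w 0 (x j r) = y 0 r) -> private_zero j y.
Proof.
move=> wA wy i a ki id; have w0 := iffLR (rep w) wA i a id.
have [[r la]|no] := classic (exists r, l i (x j r) = a); last first.
  rewrite lsum_push big_pred0 // => r; apply/negP => /eqP la.
  by apply: no; exists r.
rewrite -w0; apply/eqP; rewrite -subr_eq0 -lsumB; apply/eqP.
apply: lsum_outside => e; apply: contra_neq => le.
have [|r' ->] := l_private (j := j) (r := r) ki id (e := e); first by rewrite le la.
by rewrite rVsubE push_in wy subrr.
Qed.

(** Copy [j0] is to be restored, [j2] is the fixed copy, and [cand] lists the other [t]. The second
    forest describes the vectors vanishing on [j0]. *)
Variables (h : nat) (c' : nat -> 'I_n -> F) (l' : nat -> 'I_n -> nat).
Let j0 : 'I_t.+2 := ord0.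
Let j2 : 'I_t.+2 := lift ord0 ord0.
Let cand (p : 'I_t) : 'I_t.+2 := rshift 2 p.
Hypothesis l'_ref : refining l'.
Hypothesis rep' : forall w : 'rV[F]_n, (forall r, w 0 (x j0 r) = 0) ->
  ((w <= A)%MS <-> forall i a, (i < h)%N -> lsum c' l' w i a = 0).
Hypothesis many : (s * h < t)%N.

Definition base_node i a := [exists r, l' i (x j2 r) == a].

(** The copy meets the span of the nodes used by [j2] only in the part that all copies share. *)
Definition spread j := forall y : 'rV[F]_s,
  (forall i a, (i < h)%N -> ~~ base_node i a -> lsum c' l' (push j y) i a = 0) ->
  private_zero j y.

(* There are at most s * h base nodes, so among more than s * h copies violating
   [spread] some combination would vanish in the second forest; it would then be a
   relation, contradicting the independence of the copies modulo the shared nodes. *)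
Lemma exists_spread : exists p, spread (cand p).
Proof.
apply: NNPP => none.
have [Y YP] : exists Y : 'I_t -> 'rV[F]_s, forall p,
    (forall i a, (i < h)%N -> ~~ base_node i a -> lsum c' l' (push (cand p) (Y p)) i a = 0)
    /\ ~ private_zero (cand p) (Y p).
  apply: (@fin_all_exists _ _ (fun p y =>
    (forall i a, (i < h)%N -> ~~ base_node i a -> lsum c' l' (push (cand p) y) i a = 0)
    /\ ~ private_zero (cand p) y)) => p.
  apply: NNPP => no; apply: none; exists p => y y0; apply: NNPP => ny.
  by apply: no; exists y.
(* A level and a column of [j2] name a base node, possibly repeatedly; so [M] has fewer columns than
   rows and a nonzero left kernel vector. *)
pose M := \matrix_(p < t, q < #|{: 'I_h * 'I_s}|)
  lsum c' l' (push (cand p) (Y p)) (enum_val q).1 (l' (enum_val q).1 (x j2 (enum_val q).2)).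
have : kermx M != 0.
  rewrite kermx_eq0 /row_free neq_ltn (leq_ltn_trans (rank_leq_col _)) //.
  by rewrite card_prod !card_ord mulnC.
case/rowV0Pn => v /sub_kermxP vM v0.
pose w := \sum_p v 0 p *: push (cand p) (Y p).
have cand_inj p p' : cand p = cand p' -> p = p'.
  by move/(congr1 val) => /= /eqP; rewrite eqn_add2l => /eqP/val_inj.
have w_in p r : w 0 (x (cand p) r) = (v 0 p *: Y p) 0 r.
  rewrite summxE (bigD1 p) //= mxE push_in big1 ?addr0 ?mxE // => p' p'p.
  by rewrite mxE push_other ?mulr0 //; apply: contraNneq p'p => /cand_inj ->.
have wA : (w <= A)%MS.
  apply/rep' => [r|i a ih].
    by rewrite summxE big1 // => p _; rewrite mxE push_other ?mulr0.
  rewrite lsum_sum; case: (boolP (base_node i a)) => [/existsP[r /eqP <-]|na].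
    have := congr1 (fun z : 'rV_#|{: 'I_h * 'I_s}| => z 0 (enum_rank (Ordinal ih, r))) vM.
    rewrite [RHS]mxE mxE => vM0; rewrite -[RHS]vM0; apply: eq_bigr => p _.
    by rewrite mxE enum_rankK.
  by rewrite big1 // => p _; rewrite (proj1 (YP p)) ?mulr0.
have [p vp] : exists p, v 0 p != 0.
  apply: NNPP => no; case/negP: v0; apply/eqP/rowP => p; rewrite mxE.
  by apply/eqP/negPn/negP => vp; apply: no; exists p.
apply: (proj2 (YP p)) => i a ki id.
have pz : private_zero (cand p) (v 0 p *: Y p) := sub_private_zero wA (w_in p).
have := pz i a ki id.
rewrite /push -scalemxAl lsumZ => /eqP; rewrite mulf_eq0 (negPf vp) => /eqP.
exact.
Qed.

(** Each column of [j0] follows the path of its counterpart in a spread copy [j1], reusing base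
    nodes and receiving duplicates of all others. *)
Lemma duplicate_copy : tree_rep h [set: 'I_n] (fun w => (w <= A)%MS).
Proof.
have [p spr] := exists_spread; set j1 := cand p in spr.
have j10 : j1 != j0 by [].
have j20 : j2 != j0 by [].
pose moved e := [exists r, x j0 r == e].
pose sg e := if [pick r | x j0 r == e] is Some r then x j1 r else e.
have moved_x r : moved (x j0 r) by apply/existsP; exists r.
have sg_x r : sg (x j0 r) = x j1 r.
  rewrite /sg; case: pickP => [r' /eqP/x_inj[_ -> //]|/(_ r)]; by rewrite eqxx.
have sg_id e : ~~ moved e -> sg e = e.
  by move=> ne; rewrite /sg; case: pickP => // r xr; case/existsP: ne; exists r.
pose fresh i e := moved e && ~~ base_node i (l' i (sg e)).
pose c2 i e := c' i (sg e).
(* Odd labels are the duplicates, even labels the original nodes. *)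
pose l2 i e := (fresh i e + (l' i (sg e)).*2)%N.
have l2_eq i e (b : bool) a : (l2 i e == b + a.*2)%N = (fresh i e == b) && (l' i (sg e) == a).
  apply/eqP/andP => [E|[/eqP <- /eqP <-] //].
  have := congr1 odd E; have := congr1 half E; rewrite /l2 !half_bit_double => ->.
  by rewrite !oddD !odd_double !addbF !oddb => ->; rewrite !eqxx.
exists c2, l2; split=> [i e e' /eqP|w _].
  rewrite {2}/l2 l2_eq => /andP[/eqP fe /eqP lS]; have lE := l'_ref lS.
  (* Base nodes are closed under parents: a path that has left them never returns, so parents stay
     unique after duplication. *)
  have base_up f : base_node i.+1 (l' i.+1 f) -> base_node i (l' i f).
    by case/existsP => r /eqP/l'_ref rf; apply/existsP; exists r; rewrite rf.
  move: fe; rewrite /l2 /fresh lE lS.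
  case: (boolP (base_node i (l' i (sg e')))) => nb; first by rewrite !andbF.
  by rewrite (contra (base_up (sg e')) nb) !andbT => ->.
pose y : 'rV[F]_s := \row_r w 0 (x j0 r).
pose wR := w - push j0 y.
have wR0 r : wR 0 (x j0 r) = 0.
  by rewrite rVsubE push_in mxE subrr.
have wE : w = wR + 1 *: push j0 y by rewrite scale1r subrK.
have lsum2R i (b : bool) a : lsum c2 l2 wR i (b + a.*2)%N = if b then 0 else lsum c' l' wR i a.
  have E e : wR 0 e != 0 -> ~~ moved e.
    by apply: contraNN => /existsP[r /eqP <-]; rewrite wR0.
  case: b.
    apply: lsum_outside => e /E ne; rewrite l2_eq /fresh (negPf ne) //.
  rewrite /lsum big_mkcond [RHS]big_mkcond; apply: eq_bigr => e _.
  rewrite (l2_eq _ _ false); case: (eqVneq (wR 0 e) 0) => [->|/E ne].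
    by rewrite !mulr0; do 2 case: ifP.
  by rewrite /fresh (negPf ne) /= sg_id // /c2 sg_id.
have lsum2P i (b : bool) a : lsum c2 l2 (push j0 y) i (b + a.*2)%N =
    if b == ~~ base_node i a then lsum c' l' (push j1 y) i a else 0.
  rewrite !lsum_push.
  transitivity (\sum_(r | (l' i (x j1 r) == a) && (b == ~~ base_node i a))
                   c' i (x j1 r) * y 0 r).
    apply: eq_big => r; last by rewrite /c2 sg_x.
    rewrite l2_eq /fresh moved_x sg_x /= andbC [_ == b]eq_sym.
    by case: (eqVneq (l' i (x j1 r)) a) => // ->.
  case: ifP => _; first by under eq_bigl do rewrite andbT.
  by under eq_bigl do rewrite andbF; rewrite big_pred0_eq.
have w'0 r : (wR + 1 *: push j1 y) 0 (x j0 r) = 0.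
  by rewrite mxE wR0 mxE push_other // mulr0 addr0.
(* Odd nodes say that the pattern, placed on [j1], vanishes off the base nodes; given this, even
   nodes say that moving it from [j0] to [j1] lands in the row space. *)
have cond2 : (forall i a, (i < h)%N -> lsum c2 l2 w i a = 0) <->
    (forall i a, (i < h)%N -> ~~ base_node i a -> lsum c' l' (push j1 y) i a = 0) /\
    ((wR + 1 *: push j1 y)%R <= A)%MS.
  rewrite (rep' w'0); split=> [w0|[p0 w0] i b ih].
    have p0 i a : (i < h)%N -> ~~ base_node i a -> lsum c' l' (push j1 y) i a = 0.
      move=> ih na; have := w0 i (true + a.*2)%N ih.
      by rewrite wE lsum_lin lsum2R lsum2P na add0r mul1r.
    split=> // i a ih; have := w0 i (false + a.*2)%N ih.
    rewrite wE !lsum_lin lsum2R lsum2P /=.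
    by case: (boolP (base_node i a)) => [//|na]; rewrite p0.
  rewrite -(odd_double_half b) wE lsum_lin lsum2R lsum2P.
  case: (odd b); case: (boolP (base_node _ _)) => nb /=; rewrite ?mulr0 ?addr0 //.
  - by rewrite p0 // mulr0 addr0.
  - by rewrite -lsum_lin w0.
  - by have := w0 i b./2 ih; rewrite lsum_lin p0 // mulr0 addr0.
rewrite cond2; split=> [wA|[p0 w'A]].
  have z0 : private_zero j0 y by apply: (sub_private_zero wA) => r; rewrite mxE.
  split=> [i a ih na|].
    (* Off the base nodes [push j2 y] contributes nothing, so the vanishing of this difference
       passes to [push j1 y]. *)
    have dA : (push j1 y - push j2 y <= A)%MS.
      by apply: private_zero_sub; apply: private_zero_copy z0.
    have d0 r : (push j1 y - push j2 y) 0 (x j0 r) = 0.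
      by rewrite rVsubE !push_other // subrr.
    have := iffLR (rep' d0) dA i a ih.
    rewrite lsumB [lsum _ _ (push j2 y) _ _]lsum_push big_pred0 ?subr0 // => r.
    by apply: contraNF na => la; apply/existsP; exists r.
  have -> : wR + 1 *: push j1 y = w - (push j0 y - push j1 y).
    by rewrite scale1r opprB addrA addrAC.
  by rewrite addmx_sub // eqmx_opp; apply: private_zero_sub.
(* Spreadness puts the pattern into the shared part, so it can be moved back to [j0]. *)
have := private_zero_sub j0 (spr y p0).
move: w'A; rewrite wE !scale1r => w'A dA.
have -> : wR + push j0 y = (wR + push j1 y) - (push j1 y - push j0 y).
  by rewrite opprB addrA addrAC addrK.
by rewrite addmx_sub // eqmx_opp.
Qed.

End Duplication.

(** * Counting *)

(** Here [j] counts levels up from the leaves and [N] bounds a child block. The inner factors count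
    sizes, coefficient tables, patterns of equal labels, and copies allowed per type. *)
Fixpoint block_bound (q d j : nat) : nat :=
  if j is j'.+1 then
    let N := block_bound q d j' in
    N * (N.+1 * q ^ (N * d) * 2 ^ (N * N * d) * (N * d + 2))
  else 1.

Section Counting.
Local Open Scope nat_scope.
Variables (F : finFieldType) (n m : nat) (A : 'M[F]_(m, n)).
Variables (d : nat) (c : nat -> 'I_n -> F) (l : nat -> 'I_n -> nat).
Hypothesis l_ref : refining l.
Hypothesis rep : forall w : 'rV[F]_n, (w <= A)%MS <->
  forall i a, i < d -> lsum c l w i a = 0%R.

(* The extra level d separates all columns, so that blocks of level d + 1 are singletons. *)
Definition leaf_label i (e : 'I_n) : nat := if i < d then l i e else e.

(** The index is shifted: the columns agree with [e] on all levels below [i], so level 0 gives the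
    whole ground set. *)
Definition block i e : {set 'I_n} :=
  if i is i'.+1 then [set e' | leaf_label i' e' == leaf_label i' e] else setT.

Lemma leaf_label_ref : refining leaf_label.
Proof.
move=> i e e'; rewrite /leaf_label; case: ltnP => [id|_ /val_inj -> //].
by rewrite (ltnW id); apply: l_ref.
Qed.

Lemma block_self i e : e \in block i e.
Proof. by case: i => [|i]; rewrite inE. Qed.

Lemma block_disjoint i e1 e2 e : e \in block i e1 -> e \in block i e2 -> block i e1 = block i e2.
Proof.
by case: i => //= i; rewrite !inE => /eqP e1P /eqP e2P; apply/setP => f; rewrite !inE -e1P e2P.
Qed.

Lemma block_shared i k e e' : e' \in block k e -> i < k -> i < d -> l i e' = l i e.
Proof.
case: k => // k; rewrite inE ltnS => /eqP E ik id.
by have := refining_le leaf_label_ref ik E; rewrite /leaf_label id.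
Qed.

(** The isomorphism type of a block over its path. Positions beyond its size default to [e0], and
    [inord] is faithful for at most [N] columns. *)
Definition block_type N e0 (C : {set 'I_n}) :
    'I_N.+1 * {ffun 'I_N * 'I_d -> F} * {ffun 'I_N * 'I_N * 'I_d -> bool} :=
  let z (r : 'I_N) := nth e0 (enum C) r in
  (inord #|C|, [ffun p : 'I_N * 'I_d => c p.2 (z p.1)],
   [ffun p : 'I_N * 'I_N * 'I_d => l p.2 (z p.1.1) == l p.2 (z p.1.2)]).

Variable h : nat.
Hypothesis hd : h < d.
Hypothesis puncture : forall e, tree_rep h [set~ e] (fun w => (w <= A)%MS).
Hypothesis critical : ~ tree_rep h [set: 'I_n] (fun w => (w <= A)%MS).

Lemma same_type_blocks k N e0 (Q : {set {set 'I_n}}) tau : k <= d ->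
  (forall e, #|block k.+1 e| <= N) ->
  Q \subset [set block k.+1 e | e in block k e0] ->
  (forall C, C \in Q -> block_type N e0 C = tau) ->
  #|Q| <= N * d + 2.
Proof.
move=> kd leN Qblock Qtau; rewrite leqNgt; apply/negP => manyQ.
have QP C : C \in Q -> exists2 e, e \in block k e0 & C = block k.+1 e.
  by move/(subsetP Qblock) => /imsetP.
(* Besides the restored and the fixed copy, [t] candidates remain, more than the [s * h] needed. *)
pose t := (N * d).+1; pose s := val tau.1.1.
have tQ : t.+2 <= #|Q| by rewrite addn2 in manyQ.
have Qlt (j : 'I_t.+2) : j < size (enum Q) by rewrite -cardE; apply: leq_trans tQ.
pose C (j : 'I_t.+2) := nth set0 (enum Q) j.
have CQ j : C j \in Q by rewrite -mem_enum mem_nth.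
have C_inj j j' : C j = C j' -> j = j'.
  by move/eqP; rewrite nth_uniq ?enum_uniq // => /eqP/val_inj.
have cardC j : #|C j| = s.
  have [e _ Ce] := QP _ (CQ j).
  have <- : val (block_type N e0 (C j)).1.1 = s by rewrite Qtau.
  by rewrite /= inordK // Ce ltnS.
have sN : s <= N by rewrite -(cardC ord0); have [e _ ->] := QP _ (CQ ord0).
pose x (j : 'I_t.+2) (r : 'I_s) := nth e0 (enum (C j)) r.
have xC j r : x j r \in C j by rewrite -mem_enum mem_nth // -cardE cardC.
have x_onto j e : e \in C j -> exists r, e = x j r.
  rewrite -mem_enum => eC; have lt : index e (enum (C j)) < s.
    by rewrite -(cardC j) cardE index_mem.
  by exists (Ordinal lt); rewrite /x nth_index.
have C_disjoint j j' e : e \in C j -> e \in C j' -> j = j'.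
  have [f _ Cf] := QP _ (CQ j); have [f' _ Cf'] := QP _ (CQ j').
  rewrite Cf Cf' => ef ef'; apply: C_inj; rewrite Cf Cf'.
  exact: block_disjoint ef ef'.
have x_inj j j' r r' : x j r = x j' r' -> j = j' /\ r = r'.
  move=> E; have jj' : j = j' by apply: (@C_disjoint _ _ (x j r)); rewrite ?xC // E xC.
  split=> //; move: E; rewrite -jj' => /eqP; rewrite nth_uniq ?enum_uniq -?cardE ?cardC //.
  by move/eqP/val_inj.
have c_copy i j j' r : i < d -> c i (x j r) = c i (x j' r).
  move=> id; pose p := (widen_ord sN r, Ordinal id).
  have : (block_type N e0 (C j)).1.2 p = (block_type N e0 (C j')).1.2 p by rewrite !Qtau.
  by rewrite !ffunE.
have l_copy i j j' r r' : i < d ->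
    (l i (x j r) == l i (x j r')) = (l i (x j' r) == l i (x j' r')).
  move=> id; pose p := (widen_ord sN r, widen_ord sN r', Ordinal id).
  have : (block_type N e0 (C j)).2 p = (block_type N e0 (C j')).2 p by rewrite !Qtau.
  by rewrite !ffunE.
have l_shared i j j' r r' : i < k -> i < d -> l i (x j r) = l i (x j' r').
  have base j1 r1 : i < k -> i < d -> l i (x j1 r1) = l i e0.
    move=> ik id; have [e ek Ce] := QP _ (CQ j1); have := xC j1 r1; rewrite Ce => xe.
    by rewrite (block_shared xe (ltnW ik) id) (block_shared ek ik id).
  by move=> ik id; rewrite !base.
have l_private i j r e : k <= i -> i < d -> l i e = l i (x j r) -> exists r', e = x j r'.
  move=> ki id le; apply: x_onto; have := xC j r.
  have [f _ ->] := QP _ (CQ j); rewrite !inE /leaf_label (leq_ltn_trans ki id).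
  by rewrite (refining_le l_ref ki le).
have [e1 e1C] : exists e, e \in C ord0.
  by have [e _ ->] := QP _ (CQ ord0); exists e; apply: block_self.
have [r1 e1x] := x_onto _ _ e1C.
(* One column of copy 0 suffices, as vectors vanishing on the whole copy vanish at [e1]. *)
have [c' [l' [l'_ref rep']]] := puncture e1.
apply: critical; apply: (@duplicate_copy _ _ _ A d s t k x x_inj c l rep c_copy
   l_copy l_shared l_private h c' l' l'_ref).
- move=> w w0; apply: rep'; apply/rsuppP => e; rewrite !inE negbK => /eqP ->.
  by rewrite e1x.
- by rewrite ltnS leq_mul // ltnW.
Qed.

(** Induction from the singletons at level [d.+1] towards the roots, sorting the child blocks by
    type. *)
Lemma block_card j k e : j + k = d.+1 -> #|block k e| <= block_bound #|F| d j.
Proof.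
elim: j k e => [|j IH] k e0.
  rewrite add0n => ->; rewrite (eq_card (B := [set e0])) ?cards1 // => e.
  by rewrite !inE /leaf_label ltnn.
move=> jk; have leN e : #|block k.+1 e| <= block_bound #|F| d j by apply: IH; rewrite addnS -jk.
have kd : k <= d by rewrite -ltnS -jk addSn ltnS leq_addl.
rewrite /=; set N := block_bound _ _ j in leN *.
set P := [set block k.+1 e | e in block k e0].
have coverP : block k e0 \subset cover P.
  apply/subsetP => e ek; apply/bigcupP; exists (block k.+1 e); last exact: block_self.
  exact: imset_f.
apply: leq_trans (subset_leq_card coverP) _.
apply: leq_trans (leq_card_cover P) _.
apply: (@leq_trans (\sum_(C in P) N)).
  by apply: leq_sum => C /imsetP[e _ ->].
rewrite sum_nat_const mulnC leq_mul2l; apply/orP; right.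
pose T : finType := ('I_N.+1 * {ffun 'I_N * 'I_d -> F} * {ffun 'I_N * 'I_N * 'I_d -> bool})%type.
have cardT : #|T| = N.+1 * #|F| ^ (N * d) * 2 ^ (N * N * d).
  by rewrite !card_prod !card_ffun !card_prod !card_ord card_bool.
rewrite -cardT -sum1_card (partition_big (block_type N e0) predT) //=.
apply: (@leq_trans (\sum_(tau : T) (N * d + 2))); last by rewrite sum_nat_const.
apply: leq_sum => tau _; rewrite sum1dep_card.
apply: (@same_type_blocks k N e0 _ tau) => //.
  by apply/subsetP => C; rewrite inE => /andP[].
by move=> C; rewrite inE => /andP[_ /eqP].
Qed.

End Counting.

Theorem theorem3 :
  exists f : nat -> nat -> nat,
  forall (F : finFieldType) (d n m : nat) (A : 'M[F]_(m, n)),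
    dsd A [set: 'I_n] d ->
    (forall e : 'I_n, exists (k : nat) (B : 'M[F]_(k, n)) (d' : nat),
        [/\ represents_contraction A e B, dsd B [set~ e] d' & (d' < d)%N]) ->
    (n <= f #|F| d)%N.
Proof.
(* The extra level is the one separating the columns below the [d] levels of the forest. *)
exists (fun q d => block_bound q d d.+1) => F d n m A [dsdA minA] contr.
case: n => [//|n] in A dsdA minA contr *.
have colselT : colsel F [set: 'I_n.+1] = 1%:M.
  by apply/matrixP => i j; rewrite !mxE inE.
have [c [l [l_ref rep]]] := dsd_le_tree dsdA.
(* Depth 0 is impossible once a column exists, since its contraction would be of smaller depth. *)
case: d => [|h] in dsdA minA contr rep *.
  by have [k [B [d' []]]] := contr ord0.
have := @block_card F _ _ A h.+1 c l l_ref _ h (ltnSn h) _ _ h.+2 0 ord0 (addn0 _).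
rewrite cardsT card_ord; apply.
- move=> w; rewrite -rep ?subsetT // /rowspan colselT mulmx1; exact: iff_refl.
- move=> e; have [k [B [d' [AB [dsdB _] d'h]]]] := contr e.
  exact: tree_rep_mono (contraction_tree AB dsdB).
- move=> repA; apply: (minA h) => //; apply: tree_dsd_le.
  by rewrite /rowspan colselT mulmx1.
Qed.
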